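(* For every odd integer $q>1$, the set $G^\ast_q/R^\ast_q$, equipped with the binary operation $\overline{a}\,\overline{b}=\overline{a\ast b}$, is a commutative group.
   Context: Let $q>1$ be an odd integer, and let $\mathbf{N}=\{0,1,2,\dots\}$. Let $G_q$ be the set of all positive odd integers less than $q$, and let $G^\ast_q$ be the set of all elements of $G_q$ that are coprime to $q$. Operation $\ast$ on $G^\ast_q$: for $a,b\in G^\ast_q$, let $a\ast b=\frac{ab-sq}{2^t}$, where $s\in\mathbf{N}$ is such that $0<ab-sq<q$ and $t\in\mathbf{N}$ is such that $\frac{ab-sq}{2^t}$ is an odd integer. (That is, $a\ast b$ is the odd part of the remainder of $ab$ modulo $q$.) Cycles: for $a_1\in G^\ast_q$, define successively $a_{i+1}=\frac{q+a_i}{2^{k_i}}$, where $k_i\ge 1$ is the integer for which $a_{i+1}$ is odd, until the first $n\geq 1$ with $a_{n+1}=a_1$. This gives a cycle $(a_1,a_2,\dots,a_n)$, and $\overline{a_1}$ denotes the set $\{a_1,a_2,\dots,a_n\}$ (so $\overline{a_1}=\overline{a_i}$ for each $i$). Relation: $R^\ast_q=\{(m,n)\in G^\ast_q\times G^\ast_q : \text{there exists } a_1\in G^\ast_q \text{ such that } m,n\in\overline{a_1}\}$. This is an equivalence relation on $G^\ast_q$ that is compatible with $\ast$ (if $x\sim y$ and $u\sim v$ then $x\ast u\sim y\ast v$), the equivalence class of $x$ is $\overline{x}$, and $G^\ast_q/R^\ast_q$ denotes the set of equivalence classes. The operation on $G^\ast_q/R^\ast_q$ is $\overline{a}\,\overline{b}=\overline{a\ast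 b}$. *)

(* Defs.v *)
From HB Require Import structures.
From mathcomp Require Import all_boot zify.

Set Implicit Arguments.
Unset Strict Implicit.
Unset Printing Implicit Defensive.

(* The set G*_q; positivity of the elements follows from their oddness. *)
Record Gstar (q : nat) := MkGstar {
  gval :> 'I_q;
  _ : odd gval && coprime gval q }.

HB.instance Definition _ q := [isSub for @gval q].
HB.instance Definition _ q := [Finite of Gstar q by <:].

Lemma odd_part2' n : 0 < n -> odd n`_2^'.
Proof.
move=> n0; rewrite -[odd _]negbK -dvdn2; apply/negP => d2.
by have /pnatP/(_ 2 isT d2) := part_pnat 2^' n; rewrite part_gt0 !inE => /(_ isT).
Qed.

Lemma Gstar_odd q (a : Gstar q) : odd a.
Proof. by case: a => a /= /andP[]. Qed.

Lemma Gstar_coprime q (a : Gstar q) : coprime a q.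
Proof. by case: a => a /= /andP[]. Qed.

Lemma Gstar_lt q (a : Gstar q) : a < q.
Proof. exact: ltn_ord. Qed.

Lemma Gstar_gt0 q (a : Gstar q) : 0 < a.
Proof. by apply: odd_gt0; exact: Gstar_odd. Qed.

Lemma Gstar_gt1 q (a : Gstar q) : 1 < q.
Proof. exact: leq_ltn_trans (Gstar_gt0 a) (Gstar_lt a). Qed.

Lemma coprime_part q n pi : 0 < n -> coprime n q -> coprime n`_pi q.
Proof. by move=> n0; apply: coprime_dvdl; exact: dvdn_part. Qed.

Lemma star_coprime q (a b : Gstar q) : coprime (a * b %% q) q.
Proof. by rewrite coprime_modl coprimeMl !Gstar_coprime. Qed.

Lemma star_gt0 q (a b : Gstar q) : 0 < a * b %% q.
Proof.
have := star_coprime a b; case: (_ %% q) => // ; rewrite /coprime gcd0n.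
by have := Gstar_gt1 a; case: q a b => [|[]].
Qed.

Lemma star_lt q (a b : Gstar q) : (a * b %% q)`_2^' < q.
Proof.
apply: leq_ltn_trans (dvdn_leq (star_gt0 a b) (dvdn_part _ _)) _.
by rewrite ltn_mod; apply: ltnW; exact: Gstar_gt1 a.
Qed.

Lemma star_subproof q (a b : Gstar q) :
  odd (Ordinal (star_lt a b)) && coprime (Ordinal (star_lt a b)) q.
Proof.
by rewrite /= odd_part2' ?star_gt0 // coprime_part ?star_gt0 ?star_coprime.
Qed.

(* n`_2^' is the odd part of n > 0, i.e. n divided by 2 ^ logn 2 n. *)
Definition star q (a b : Gstar q) : Gstar q := MkGstar (star_subproof a b).

Lemma next_lt q (oq : odd q) (a : Gstar q) : (q + a)`_2^' < q.
Proof.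
have n0 : 0 < q + a by rewrite addn_gt0 Gstar_gt0 orbT.
have ev : ~~ odd (q + a) by rewrite oddD oq Gstar_odd.
have := partnC 2 n0; have := Gstar_lt a; have := ev; rewrite -dvdn2.
rewrite p_part => ev2.
have : 0 < logn 2 (q + a) by rewrite logn_gt0 mem_primes /= n0.
case: (logn _ _) => // k _; rewrite expnS => aq E.
have : 0 < 2 ^ k by rewrite expn_gt0.
by nia.
Qed.

Lemma next_subproof q (oq : odd q) (a : Gstar q) :
  odd (Ordinal (next_lt oq a)) && coprime (Ordinal (next_lt oq a)) q.
Proof.
have n0 : 0 < q + a by rewrite addn_gt0 Gstar_gt0 orbT.
rewrite /= odd_part2' // coprime_part //.
by rewrite -coprime_modl modnDl coprime_modl Gstar_coprime.
Qed.

(* The step a_i |-> a_{i+1}. *)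
Definition next q (oq : odd q) (a : Gstar q) : Gstar q :=
  MkGstar (next_subproof oq a).

Lemma next_inj q (oq : odd q) : injective (next oq).
Proof.
move=> a b /(congr1 (fun x : Gstar q => (x : nat))) /= E.
apply/val_inj/val_inj => /=.
have na : 0 < q + a by rewrite addn_gt0 Gstar_gt0 orbT.
have nb : 0 < q + b by rewrite addn_gt0 Gstar_gt0 orbT.
have Ea := partnC 2 na; have Eb := partnC 2 nb.
move: Ea Eb; rewrite E !p_part.
have := Gstar_lt a; have := Gstar_lt b.
have := Gstar_gt0 a; have := Gstar_gt0 b.
set c := _`_2^'; set k := logn _ _; set l := logn _ _ => b0 a0 bq aq Ea Eb.
have [kl|lk|kl] := ltngtP k l.
- have : 2 ^ k.+1 <= 2 ^ l by rewrite leq_exp2l.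
  by rewrite expnS; nia.
- have : 2 ^ l.+1 <= 2 ^ k by rewrite leq_exp2l.
  by rewrite expnS; nia.
- by move: Eb; rewrite -kl Ea => /addnI.
Qed.

(* The set of the elements of the cycle starting at a. As next oq is
   injective, [orbit (next oq) a] is the duplicate-free sequence
   a, next a, next (next a), ... which stops just before the first return
   to a (see orbit_uniq and iter_order). *)
Definition cyc q (oq : odd q) (a : Gstar q) : {set Gstar q} :=
  [set b in orbit (next oq) a].

Definition Rstar q (oq : odd q) : rel (Gstar q) := fun m n =>
  [exists a1 : Gstar q, (m \in cyc oq a1) && (n \in cyc oq a1)].

Lemma RstarE q (oq : odd q) (m n : Gstar q) :
  Rstar oq m n = (n \in cyc oq m).
Proof.
rewrite /Rstar inE -fconnect_orbit; apply/existsP/idP => [[a]|mn].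
  rewrite !inE -!fconnect_orbit fconnect_sym; last exact: next_inj.
  by case/andP; exact: connect_trans.
by exists m; rewrite !inE -!fconnect_orbit connect0.
Qed.

Lemma Rstar_equiv q (oq : odd q) : equivalence_rel (Rstar oq).
Proof.
have sym := fconnect_sym (@next_inj q oq).
move=> x y z; rewrite !RstarE !inE -!fconnect_orbit connect0; split=> // xy.
by apply/idP/idP; apply: connect_trans; rewrite // sym.
Qed.

(* The set G*_q / R*_q of equivalence classes, as a type. *)
Definition Gquot q (oq : odd q) :=
  {C : {set Gstar q} | C \in equivalence_partition (Rstar oq) [set: Gstar q]}.

Lemma cyc_class q (oq : odd q) (a : Gstar q) :
  cyc oq a \in equivalence_partition (Rstar oq) [set: Gstar q].
Proof.
apply/imsetP; exists a; rewrite ?inE //.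
by apply/setP => b; rewrite [RHS]inE in_setT RstarE.
Qed.

Definition cls q (oq : odd q) (a : Gstar q) : Gquot oq :=
  exist _ (cyc oq a) (cyc_class oq a).

Definition is_comm_group (T : Type) (op : T -> T -> T) : Prop :=
  [/\ associative op, commutative op &
      exists e : T, exists inv : T -> T,
        left_id e op /\ left_inverse e inv op].

(* Main.v *)
Require Import Defs.
From mathcomp Require Import all_boot cyclic.

(** The group in question is the quotient of the unit group of Z/q by its
    subgroup generated by 2.  The point is that two elements of G*_q lie on
    the same cycle exactly when they agree modulo q up to powers of 2
    ([cls_eqP]).  In one direction, a step of the cycle replaces a by
    (q + a) / 2 ^ k, which is a divided by a power of 2 modulo q.  In the
    other direction, division by 2 on the residues 1, ..., q - 1 sends an even
    x to x / 2 and an odd x to (q + x) / 2.  Iterating it from an odd a runs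
    through all residues a / 2 ^ k, and the odd residues met on the way are
    exactly the successive elements of the cycle of a
    ([fconnect_next_of_modn]).

    Taking odd parts is also a division by a power of 2, so that star a b
    agrees with a * b up to powers of 2 ([star_eqmod2]).  Every law to be
    checked on classes thereby becomes the corresponding law for the product
    of natural numbers, and inverses come from Euler's theorem. *)

Set Implicit Arguments.
Unset Strict Implicit.
Unset Printing Implicit Defensive.

(* The step of the cycles, as opposed to the successor in a sequence. *)
Local Notation next := Defs.next.

Lemma modn_mulIr q c m n :
  coprime q c -> m * c = n * c %[mod q] -> m = n %[mod q].
Proof.
move=> qc; wlog le_nm : m n / n <= m => [W E|/eqP E].
  by case/orP: (leq_total n m) => /W H; [|apply: esym]; apply: H.
apply/eqP; move: E.
by rewrite !eqn_mod_dvd ?leq_mul2r ?le_nm ?orbT // -mulnBl Gauss_dvdl.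
Qed.

(** Allowing a power of 2 on both sides makes symmetry and transitivity
    immediate, with no need to invert 2 modulo q. *)
Definition eqmod2 q m n := exists k l, m * 2 ^ k = n * 2 ^ l %[mod q].

Lemma eqmod2_mod q m n : m = n %[mod q] -> eqmod2 q m n.
Proof. by move=> E; exists 0, 0; rewrite !muln1. Qed.

Lemma eqmod2_refl q m : eqmod2 q m m.
Proof. exact: eqmod2_mod. Qed.

Lemma eqmod2_sym q m n : eqmod2 q m n -> eqmod2 q n m.
Proof. by case=> k [l E]; exists l, k. Qed.

Lemma eqmod2_trans q n m p : eqmod2 q m n -> eqmod2 q n p -> eqmod2 q m p.
Proof.
case=> k [l Emn] [i [j Enp]]; exists (k + i), (j + l).
rewrite !expnD !mulnA -modnMml Emn modnMml.
by rewrite mulnAC -modnMml Enp modnMml.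
Qed.

Lemma eqmod2M q m m' n n' :
  eqmod2 q m m' -> eqmod2 q n n' -> eqmod2 q (m * n) (m' * n').
Proof.
case=> k [l Em] [i [j En]]; exists (k + i), (l + j).
by rewrite !expnD !(mulnACA _ _ (2 ^ _)) -modnMm Em En modnMm.
Qed.

Lemma eqmod2_odd_part q n : 0 < n -> eqmod2 q n`_2^' n.
Proof.
by move=> n0; exists (logn 2 n), 0; rewrite -p_part mulnC partnC // muln1.
Qed.

Section Cycles.
Variables (q : nat) (oq : odd q).
Implicit Types a b c : Gstar q.

Lemma Gstar_modn_inj a b : a = b %[mod q] -> a = b.
Proof. by rewrite !modn_small ?Gstar_lt // => /val_inj/val_inj. Qed.

Lemma next_factor a :
  exists2 j, 0 < j & next oq a * 2 ^ j = q + a.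
Proof.
have n0 : 0 < q + a by rewrite addn_gt0 Gstar_gt0 orbT.
exists (logn 2 (q + a)); last by rewrite /= -p_part mulnC partnC.
by rewrite logn_gt0 mem_primes n0 /= dvdn2 oddD oq Gstar_odd.
Qed.

Lemma eqmod2_next a : eqmod2 q (next oq a) a.
Proof.
by have [j _ E] := next_factor a; exists j, 0; rewrite E modnDl muln1.
Qed.

Lemma coprime_q_exp2 k : coprime q (2 ^ k).
Proof. by rewrite coprime_sym coprimeXl // coprime2n. Qed.

(** If b is a / 2 ^ k modulo q, compare k with the exponent j of the step
    next a = (q + a) / 2 ^ j.  When j <= k, the same situation holds for
    next a with the exponent k - j.  When 0 < k < j, b would be the residue
    (q + a) / 2 ^ k < q, which is even. *)
Lemma fconnect_next_of_modn k a b :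
  b * 2 ^ k = a %[mod q] -> fconnect (next oq) a b.
Proof.
elim/ltn_ind: k a => -[|k] IHk a E.
  by move: E; rewrite muln1 => /Gstar_modn_inj ->; exact: connect0.
have [j j0 Ej] := next_factor a.
have Eb : b * 2 ^ k.+1 = next oq a * 2 ^ j %[mod q] by rewrite Ej modnDl.
have [le_jk|lt_kj] := leqP j k.+1.
  apply: connect_trans (fconnect1 _ _) _.
  apply: (IHk (k.+1 - j)); first by rewrite ltn_subrL j0.
  by apply: (modn_mulIr (coprime_q_exp2 j)); rewrite -mulnA -expnD subnK.
move: Eb; rewrite -(subnK (ltnW lt_kj)) expnD mulnA.
move/(modn_mulIr (coprime_q_exp2 _)).
have lt_q : next oq a * 2 ^ (j - k.+1) < q.
  rewrite -(@ltn_pmul2r (2 ^ k.+1)) ?expn_gt0 // -mulnA -expnD.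
  rewrite (subnK (ltnW lt_kj)) Ej expnS mulnA muln2; apply: (@leq_trans q.*2).
    by rewrite -addnn ltn_add2l Gstar_lt.
  by rewrite leq_pmulr // expn_gt0.
rewrite !modn_small ?Gstar_lt // => Eb.
by have := Gstar_odd b; rewrite Eb oddM oddX subn_eq0 leqNgt lt_kj /= andbF.
Qed.

Lemma fconnect_nextP a b : fconnect (next oq) a b <-> eqmod2 q a b.
Proof.
split=> [/iter_findex <-|[k [l E]]].
  elim: (findex _ _ _) => [|i IHi] /=; first exact: eqmod2_refl.
  by apply: eqmod2_trans IHi _; apply: eqmod2_sym; exact: eqmod2_next.
have [le_kl|/ltnW le_lk] := leqP k l.
  apply: (@fconnect_next_of_modn (l - k)).
  by apply: (modn_mulIr (coprime_q_exp2 k)); rewrite -mulnA -expnD subnK.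
rewrite fconnect_sym; last exact: next_inj.
apply: (@fconnect_next_of_modn (k - l)).
by apply: (modn_mulIr (coprime_q_exp2 l)); rewrite -mulnA -expnD subnK.
Qed.

Lemma cls_eqP a b : cls oq a = cls oq b <-> eqmod2 q a b.
Proof.
rewrite -fconnect_nextP.
have sym := fconnect_sym (@next_inj q oq).
split=> [/(congr1 val)/= /setP/(_ b)|ab].
  by rewrite !inE -!fconnect_orbit connect0.
apply: val_inj; apply/setP=> c /=; rewrite !inE -!fconnect_orbit.
by apply/idP/idP; apply: connect_trans; rewrite // sym.
Qed.

Lemma cls_surj (C : Gquot oq) : exists a, cyc oq a == val C.
Proof.
case: C => C /= /imsetP[a _ ->]; exists a; apply/eqP/setP => b.
by rewrite [RHS]inE in_setT RstarE.
Qed.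

Definition cls_repr (C : Gquot oq) : Gstar q := xchoose (cls_surj C).

Lemma cls_reprK C : cls oq (cls_repr C) = C.
Proof. by apply: val_inj; exact/eqP/(xchooseP (cls_surj C)). Qed.

Lemma star_eqmod2 a b : eqmod2 q (star a b) (a * b).
Proof.
apply: eqmod2_trans (eqmod2_odd_part q (star_gt0 a b)) _.
by apply: eqmod2_mod; rewrite modn_mod.
Qed.

Lemma Gstar1_subproof (hq : 1 < q) :
  odd (Ordinal hq) && coprime (Ordinal hq) q.
Proof. by rewrite /= coprime1n. Qed.

Definition Gstar1 (hq : 1 < q) : Gstar q := MkGstar (Gstar1_subproof hq).

(** Iterating [star] computes a ^ (totient q - 1), the inverse of a given by
    Euler's theorem, without leaving G*_q. *)
Definition Gstar_inv (hq : 1 < q) a : Gstar q :=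
  iter (totient q).-1 (star a) (Gstar1 hq).

Lemma Gstar_inv_eqmod2 hq a : eqmod2 q (Gstar_inv hq a * a) 1.
Proof.
have Epow n : eqmod2 q (iter n (star a) (Gstar1 hq)) (a ^ n).
  elim: n => [|n IHn] /=; first exact: eqmod2_refl.
  apply: eqmod2_trans (star_eqmod2 _ _) _.
  by rewrite expnS; exact: eqmod2M (eqmod2_refl _ _) IHn.
apply: eqmod2_trans (eqmod2M (Epow _) (eqmod2_refl q a)) _.
rewrite -expnSr prednK ?totient_gt0 ?(ltnW hq) //.
by apply: eqmod2_mod; exact/Euler_exp_totient/Gstar_coprime.
Qed.

Definition cls_op (C D : Gquot oq) : Gquot oq :=
  cls oq (star (cls_repr C) (cls_repr D)).

Lemma cls_opE a b : cls_op (cls oq a) (cls oq b) = cls oq (star a b).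
Proof.
have repr_eqmod2 c : eqmod2 q (cls_repr (cls oq c)) c.
  by apply/cls_eqP; exact: cls_reprK.
apply/cls_eqP; apply: eqmod2_trans (star_eqmod2 _ _) _.
apply: eqmod2_trans (eqmod2_sym (star_eqmod2 _ _)).
exact: eqmod2M.
Qed.

End Cycles.

Theorem theorem1 (q : nat) (oq : odd q) (hq : 1 < q) :
  exists op : Gquot oq -> Gquot oq -> Gquot oq,
    (forall a b : Gstar q, op (cls oq a) (cls oq b) = cls oq (star a b)) /\
    is_comm_group op.
Proof.
exists (@cls_op q oq); split; first exact: cls_opE.
split.
- move=> C D E; rewrite -(cls_reprK C) -(cls_reprK D) -(cls_reprK E) !cls_opE.
  move: (cls_repr C) (cls_repr D) (cls_repr E) => a b c; apply/cls_eqP.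
  apply: eqmod2_trans (star_eqmod2 _ _) _.
  apply: eqmod2_trans (eqmod2M (eqmod2_refl _ _) (star_eqmod2 _ _)) _.
  rewrite mulnA; apply: eqmod2_sym.
  apply: eqmod2_trans (star_eqmod2 _ _) _.
  exact: eqmod2M (star_eqmod2 _ _) (eqmod2_refl _ _).
- move=> C D; rewrite -(cls_reprK C) -(cls_reprK D) !cls_opE; apply/cls_eqP.
  apply: eqmod2_trans (star_eqmod2 _ _) _; rewrite mulnC.
  exact: eqmod2_sym (star_eqmod2 _ _).
exists (cls oq (Gstar1 hq)).
exists (fun C => cls oq (Gstar_inv hq (cls_repr C))); split=> C.
  rewrite -[in LHS](cls_reprK C) -[RHS]cls_reprK cls_opE; apply/cls_eqP.
  by apply: eqmod2_trans (star_eqmod2 _ _) _; rewrite mul1n; exact: eqmod2_refl.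
rewrite -[X in cls_op _ X]cls_reprK cls_opE; apply/cls_eqP.
exact: eqmod2_trans (star_eqmod2 _ _) (Gstar_inv_eqmod2 _ _).
Qed.
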